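(* Let $X$ be a nonempty set. The following conditions are equivalent for every mapping $\Phi$ with the domain $X^{2}$: (i) $\Phi$ is combinatorially similar to a discrete pseudometric. (ii) There is $a_0 \in \Phi(X^{2})$ such that $\Phi$ is $a_0$-coherent and the inequality $|\Phi(X^{2})| \leqslant 2$ holds. (iii) There is $a_0 \in \Phi(X^{2})$ such that $\Phi^{-1}(a_0)$ is an equivalence relation on $X$ and the inequality $|\Phi(X^{2})| \leqslant 2$ holds.
   Context: A mapping $\Phi$ with domain $X^2$ may take values in an arbitrary set; $\Phi(X^2)$ is its image and $\Phi^{-1}(a)=\{\langle x,y\rangle\in X^2:\Phi(x,y)=a\}$. A pseudometric on a set $Y$ is a function $d\colon Y^2\to\mathbb{R}$ that is nonnegative, symmetric, satisfies $d(x,x)=0$ for all $x\in Y$, and satisfies the triangle inequality. It is discrete if $|d(Y^2)|\leqslant 2$. A mapping $\Phi$ with domain $X^2$ is combinatorially similar to a mapping $\Psi$ with domain $Y^2$ if there are bijections $f\colon\Phi(X^2)\to\Psi(Y^2)$ and $g\colon Y\to X$ such that $\Psi(x,y)=f(\Phi(g(x),g(y)))$ for all $x,y\in Y$. ''Combinatorially similar to a discrete pseudometric'' means combinatorially similar to some discrete pseudometric on some set $Y$. For $a_0\in\Phi(X^2)$, $\Phi$ is $a_0$-coherent if $\Phi^{-1}(a_0)$ is an equivalence relation on $X$ and, for all $x_1,x_2,x_3,x_4\in X$, the conditions $\Phi(x_1,x_2)=a_0$ and $\Phi(x_3,x_4)=a_0$ imply $\Phi(x_1,x_3)=\Phi(x_2,x_4)$.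 *)

(* Defs.v *)
From mathcomp Require Import all_boot all_order all_algebra.
From mathcomp Require Import boolp classical_sets functions cardinality reals.
From Stdlib Require Import RelationClasses.

Set Implicit Arguments.
Unset Strict Implicit.
Unset Printing Implicit Defensive.

Import Order.TTheory GRing.Theory Num.Theory.
Local Open Scope classical_set_scope.
Local Open Scope card_scope.
Local Open Scope ring_scope.

Definition pseudometric (R : realType) (Y : Type) (d : Y * Y -> R) : Prop :=
  [/\ forall x y, 0 <= d (x, y),
      forall x y, d (x, y) = d (y, x),
      forall x, d (x, x) = 0 &
      forall x y z, d (x, z) <= d (x, y) + d (y, z)].

Definition discrete_pseudometric (R : realType) (Y : Type) (d : Y * Y -> R) :
    Prop :=
  pseudometric d /\ range d #<= `I_2.

(* The bijection between the images is a map of the ambient codomains, of which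
   only the values on [range Phi] matter.  A map defined on [range Phi] alone
   always extends to [A] unless [B] is empty, in which case [Y] is empty. *)
Definition combinatorially_similar (X A Y B : Type)
    (Phi : X * X -> A) (Psi : Y * Y -> B) : Prop :=
  exists (f : A -> B) (g : Y -> X),
    [/\ set_bij (range Phi) (range Psi) f,
        bijective g &
        forall x y, Psi (x, y) = f (Phi (g x, g y))].

Definition similar_to_discrete_pseudometric (R : realType) (X A : Type)
    (Phi : X * X -> A) : Prop :=
  exists (Y : Type) (d : Y * Y -> R),
    discrete_pseudometric d /\ combinatorially_similar Phi d.

Definition equivalence_set (X : Type) (E : set (X * X)) : Prop :=
  Equivalence (fun x y => E (x, y)).

Definition coherent (X A : Type) (Phi : X * X -> A) (a0 : A) : Prop :=
  equivalence_set (Phi @^-1` [set a0]) /\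
  forall x1 x2 x3 x4, Phi (x1, x2) = a0 -> Phi (x3, x4) = a0 ->
    Phi (x1, x3) = Phi (x2, x4).

(* Main.v *)
(* For a pseudometric d, the triangle inequality makes d 0-coherent, and
   combinatorial similarity transports coherence and the size of the image.
   Conversely, when the image of Phi has at most two values, Phi is similar to
   the pseudometric that is 0 on Phi^-1(a0) and 1 elsewhere. *)
Require Import Defs.
From mathcomp Require Import all_boot all_order all_algebra.
From mathcomp Require Import boolp classical_sets functions cardinality reals.

Set Implicit Arguments.
Unset Strict Implicit.
Unset Printing Implicit Defensive.

Import Order.TTheory GRing.Theory Num.Theory.

Local Open Scope classical_set_scope.
Local Open Scope card_scope.

(** An injection of [S] into {0, 1} must send both [b] and [c] to the value that [a] does not
    take. *)
Lemma card_le2_neq_eq (T : Type) (S : set T) (a b c : T) :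
  S #<= `I_2 -> S a -> S b -> S c -> b <> a -> c <> a -> b = c.
Proof.
move=> /pcard_leP/injfunPex[f f_lt2 finj] Sa Sb Sc ba ca.
have neq x : S x -> x <> a -> f x != f a.
  by move=> Sx xa; apply/eqP => fxa; apply/xa/finj; rewrite ?inE.
apply: finj; rewrite ?inE//.
have /= := f_lt2 _ Sa; have /= := f_lt2 _ Sb; have /= := f_lt2 _ Sc.
have := neq b Sb ba; have := neq c Sc ca.
by move: (f a) (f b) (f c) => [|[|?]] [|[|?]] [|[|?]].
Qed.

Lemma set_bij_card_le (T U V : Type) (S : set T) (S' : set U) (B : set V)
    (f : T -> U) : set_bij S S' f -> (S #<= B) = (S' #<= B).
Proof.
move=> fbij; apply: card_le_eql.
by have /Pbij[g _] := fbij; apply: (pcard_eq g).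
Qed.

Local Open Scope ring_scope.

Lemma pseudometric_coherent (R : realType) (Y : Type) (d : Y * Y -> R) :
  pseudometric d -> coherent d 0.
Proof.
move=> [d0 dC dxx dtri]; split.
  split=> [x|x y /= dxy|x y z /= dxy dyz] /=; first exact: dxx.
    by rewrite dC.
  by apply/le_anti; rewrite d0 (le_trans (dtri x y z))// dxy dyz addr0.
(* On the path from [x1] to [x3] through [x2] and [x4], the outer legs have length 0. Since [d] is
   symmetric, the hypotheses survive swapping [x1] with [x2] and [x3] with [x4], so this bound also
   yields the reverse one. *)
have le x1 x2 x3 x4 : d (x1, x2) = 0 -> d (x3, x4) = 0 ->
    d (x1, x3) <= d (x2, x4).
  move=> d12 d34; apply: le_trans (dtri x1 x2 x3) _; rewrite d12 add0r.
  by apply: le_trans (dtri x2 x4 x3) _; rewrite (dC x4) d34 addr0.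
move=> x1 x2 x3 x4 d12 d34; apply/le_anti/andP.
by split; apply: le; rewrite // dC.
Qed.

Lemma combinatorially_similar_coherent (X A Y B : Type) (Phi : X * X -> A)
    (Psi : Y * Y -> B) (b0 : B) :
  combinatorially_similar Phi Psi -> range Psi b0 -> coherent Psi b0 ->
  exists2 a0, range Phi a0 & coherent Phi a0.
Proof.
move=> [f [g [[_ finj _] [h gK hK] PsiE]]] [[u v] _ uv].
move=> [[Erefl Esym Etrans] Ecoh].
have PhiE x y : f (Phi (x, y)) = Psi (h x, h y) by rewrite PsiE !hK.
have fI x y x' y' : f (Phi (x, y)) = f (Phi (x', y')) -> Phi (x, y) = Phi (x', y').
  by move=> /finj; apply; rewrite inE.
exists (Phi (g u, g v)); first by exists (g u, g v).
(* As [f] is injective on the image of [Phi], the fibre of [Phi] over the chosen value is the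
   pullback along [h], the inverse of [g], of the fibre of [Psi] over [b0]. *)
have a0P x y : Phi (x, y) = Phi (g u, g v) <-> Psi (h x, h y) = b0.
  by rewrite -uv -PhiE PsiE; split=> [->//|/fI].
split.
  split=> [x|x y /= /a0P xy|x y z /= /a0P xy /a0P yz] /=; apply/a0P.
  - exact: Erefl.
  - exact: Esym.
  - exact: Etrans yz.
by move=> x1 x2 x3 x4 /a0P x12 /a0P x34; apply: fI; rewrite !PhiE; apply: Ecoh.
Qed.

(** Acting on values of [Phi] rather than on pairs, it serves both to build the pseudometric and as
    the bijection between the images, with the identity of [X] as [g]. *)
Definition zero_one (R : realType) (A : Type) (a0 a : A) : R := (~~ `[< a = a0 >])%:R.

Lemma zero_one_pseudometric (R : realType) (X A : Type) (Phi : X * X -> A)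
    (a0 : A) : equivalence_set (Phi @^-1` [set a0]) ->
  pseudometric (zero_one R a0 \o Phi).
Proof.
move=> [Erefl Esym Etrans]; rewrite /zero_one; split=> /= [x y|x y|x|x y z].
- exact: ler0n.
- by congr (~~ _)%:R; apply/asbool_equiv_eq; split; apply: Esym.
- by rewrite asboolT//; exact: Erefl.
(* All terms are 0 or 1, so the triangle inequality could fail only when both terms on the right
   vanish; transitivity then makes the left one vanish too. *)
- rewrite -natrD ler_nat; case: (asboolP (Phi (x, y) = a0)) => [xy|_] /=.
    case: (asboolP (Phi (y, z) = a0)) => [yz|_] /=; last exact: leq_b1.
    by rewrite asboolT//; exact: Etrans yz.
  exact: leq_trans (leq_b1 _) (leq_addr _ _).
Qed.

Theorem theorem3p9 (R : realType) (X : Type) (hX : inhabited X)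
    (A : Type) (Phi : X * X -> A) :
  [<-> similar_to_discrete_pseudometric R Phi;
       exists a0 : A, [/\ range Phi a0, coherent Phi a0 & range Phi #<= `I_2];
       exists a0 : A, [/\ range Phi a0, equivalence_set (Phi @^-1` [set a0]) &
                          range Phi #<= `I_2]].
Proof.
tfae.
- move=> [Y [d [[dpm d2] sim]]].
  have [f [g [fbij [h _ _] _]]] := sim.
  have [x0] := hX.
  (* Nonemptiness of [X] passes to [Y] through [h], so [d] takes the value 0 on the diagonal. *)
  have d0 : range d 0.
    by exists (h x0, h x0) => //; case: dpm.
  have [a0 ra0 ca0] :=
    combinatorially_similar_coherent sim d0 (pseudometric_coherent dpm).
  by exists a0; split; rewrite // (set_bij_card_le _ fbij).
- by move=> [a0 [ra0 [ea0 _] le2]]; exists a0.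
- move=> [a0 [ra0 ea0 le2]].
  have fbij : set_bij (range Phi) (range (zero_one R a0 \o Phi)) (zero_one R a0).
    split.
    + by move=> _ [p _ <-]; exists p.
    (* [zero_one] merges all values other than [a0]; it is injective on the image because at most
       one such value occurs there. *)
    + move=> a b; rewrite !inE /zero_one => ra rb /eqP; rewrite eqr_nat.
      case: asboolP => [->|na]; case: asboolP => [->|nb]//= _.
      exact: card_le2_neq_eq le2 ra0 ra rb na nb.
    + by move=> _ [p _ <-]; exists (Phi p) => //; exists p.
  exists X, (zero_one R a0 \o Phi); split.
    split; first exact: zero_one_pseudometric.
    by rewrite -(set_bij_card_le _ fbij).
  by exists (zero_one R a0), id; split => //; exists id.
Qed.
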